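(* Let $(\mathfrak g_0^1,B_0^1,(\rho_1,V_1))$ and $(\mathfrak g_0^2,B_0^2,(\rho_2,V_2))$ be fundamental triplets over $\mathbb C$. Any isomorphism of fundamental triplets $$(A,\gamma):(\mathfrak g_0^1,B_0^1,\rho_1)\longrightarrow(\mathfrak g_0^2,B_0^2,\rho_2)$$ extends to an isomorphism of local Lie algebras $$\Psi_{(A,\gamma)}:\Gamma(\mathfrak g_0^1,B_0^1,\rho_1)\longrightarrow\Gamma(\mathfrak g_0^2,B_0^2,\rho_2)$$ (that is, $\Psi_{(A,\gamma)}$ restricts to $A$ on $\mathfrak g_0^1$ and to $\gamma$ on $V_1$). Moreover, if the subspace $\langle\rho_1(\mathfrak g_0^1).V_1\rangle$ of $V_1$ generated by the vectors $\rho_1(U)X$ ($X\in V_1$, $U\in\mathfrak g_0^1$) is equal to $V_1$, then this extension is unique.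
   Context: All vector spaces and Lie algebras are over $\mathbb C$. A quadratic Lie algebra is a pair $(\mathfrak g_0,B_0)$ where $\mathfrak g_0$ is a finite-dimensional Lie algebra and $B_0$ is a non-degenerate invariant symmetric bilinear form on $\mathfrak g_0$. A fundamental triplet $(\mathfrak g_0,B_0,(\rho,V))$ consists of a quadratic Lie algebra and a finite-dimensional representation $(\rho,V)$ of $\mathfrak g_0$; $(\rho^*,V^* )$ is the contragredient representation. An isomorphism of fundamental triplets $(\mathfrak g_0^1,B_0^1,(\rho_1,V_1))\to(\mathfrak g_0^2,B_0^2,(\rho_2,V_2))$ is a pair $(A,\gamma)$ where $A:\mathfrak g_0^1\to\mathfrak g_0^2$ is an isomorphism of Lie algebras, $\gamma:V_1\to V_2$ is an isomorphism of vector spaces, $B_0^2(A(U),A(U'))=B_0^1(U,U')$ for all $U,U'\in\mathfrak g_0^1$, and $\rho_2(A(U))\circ\gamma=\gamma\circ\rho_1(U)$ for all $U\in\mathfrak g_0^1$. A local Lie algebra is a direct sum $\Gamma=\mathfrak g_{-1}\oplus\mathfrak g_0\oplus\mathfrak g_1$ of finite-dimensional spaces with bilinear anticommutative brackets $\mathfrak g_i\times\mathfrak g_j\to\mathfrak g_{i+j}$ for $i,j\in\{-1,0,1\}$ with $|i+j|\le1$, such that the Jacobi identity holds each time its three terms are defined. Morphisms of local Lie algebras are degree-preserving linear maps compatible with all defined brackets. To a fundamental triplet one associates the local Lie algebra $\Gamma(\mathfrak g_0,B_0,\rho)=V^*\oplus\mathfrak g_0\oplus V$ (degrees $-1,0,1$)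 with the bracket of $\mathfrak g_0$, $[U,X]=\rho(U)X$, $[U,Y]=\rho^*(U)Y$, and $[X,Y]\in\mathfrak g_0$ defined by $B_0([X,Y],U)=Y(\rho(U)X)$ for all $U\in\mathfrak g_0$ ($X\in V$, $Y\in V^*$). *)

(* Defs.v *)
From HB Require Import structures.
From mathcomp Require Import all_boot all_order all_algebra.
From mathcomp Require Import sesquilinear.

Set Implicit Arguments.
Unset Strict Implicit.
Unset Printing Implicit Defensive.

Import GRing.Theory.
Local Open Scope ring_scope.

HB.mixin Record Vector_isLie (K : fieldType) g of Vector K g := {
  lie : {bilinear g -> g -> g};
  lie_alt : forall x, lie x x = 0;
  lie_jacobi : forall x y z,
    lie (lie x y) z + lie (lie y z) x + lie (lie z x) y = 0
}.

#[short(type="lieAlgType")]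
HB.structure Definition LieAlgebra (K : fieldType) :=
  {g of Vector_isLie K g & Vector K g}.

Lemma lieC (K : fieldType) (g : lieAlgType K) (x y : g) :
  lie x y = - lie y x.
Proof.
have := lie_alt (x + y); rewrite linearDl !linearDr !lie_alt add0r addr0.
by move/eqP; rewrite addr_eq0 => /eqP.
Qed.

Record quadraticLie (K : fieldType) := QuadraticLie {
  quad_lie :> lieAlgType K;
  quad_form : {symmetric quad_lie};
  quad_inv : forall x y z : quad_lie,
    quad_form (lie x y) z = quad_form x (lie y z);
  quad_nondeg : nondegenerate quad_form
}.

Record lieRep (K : fieldType) (g : lieAlgType K) (V : vectType K) := LieRep {
  rep_map :> {linear g -> 'End(V)};
  rep_lie : forall (U U' : g) (X : V),
    rep_map (lie U U') X =
      rep_map U (rep_map U' X) - rep_map U' (rep_map U X)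
}.

Record fundTriplet (K : fieldType) := FundTriplet {
  ft_alg : quadraticLie K;
  ft_space : vectType K;
  ft_rep : lieRep ft_alg ft_space
}.

Lemma repPl (K : fieldType) (g : lieAlgType K) (V : vectType K)
    (rho : lieRep g V) a (U U' : g) (X : V) :
  rho (a *: U + U') X = a *: rho U X + rho U' X.
Proof. by rewrite linearP add_lfunE scale_lfunE. Qed.

Definition dual (K : fieldType) (V : vectType K) : vectType K := 'Hom(V, K^o).

Section Contragredient.
Variables (K : fieldType) (g : lieAlgType K) (V : vectType K).
Variable rho : lieRep g V.

Definition contra_act (U : g) (Y : dual V) : dual V := - (Y \o rho U)%VF.

Fact contra_act_linear U : linear (contra_act U).
Proof.
move=> a Y Z; apply/lfunP => X.
by rewrite /contra_act !lfunE /= !lfunE /= !lfunE /= !lfunE /= opprD scalerN.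
Qed.
HB.instance Definition _ U :=
  GRing.isLinear.Build K (dual V) (dual V) _ (contra_act U)
    (contra_act_linear U).

Definition contra_map (U : g) : 'End(dual V) := linfun (contra_act U).

Lemma contra_mapE U Y X : contra_map U Y X = - Y (rho U X).
Proof. by rewrite lfunE /= /contra_act !lfunE /= lfunE. Qed.

Fact contra_map_linear : linear contra_map.
Proof.
move=> a U U'; apply/lfunP => Y; apply/lfunP => X.
rewrite contra_mapE linearP !lfunE /= !lfunE /= linearP.
by rewrite /contra_act !lfunE /= !lfunE /= scalerN opprD.
Qed.
HB.instance Definition _ :=
  GRing.isLinear.Build K g 'End(dual V) _ contra_map contra_map_linear.

Fact contra_map_lie (U U' : g) (Y : dual V) :
  contra_map (lie U U') Y =
    contra_map U (contra_map U' Y) - contra_map U' (contra_map U Y).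
Proof.
apply/lfunP => X; rewrite add_lfunE opp_lfunE !contra_mapE.
by rewrite rep_lie linearB /= !opprK opprB.
Qed.

Definition contragredient : lieRep g (dual V) := LieRep contra_map_lie.

End Contragredient.

Variant degree := DegM1 | Deg0 | Deg1.

Definition deg (i : degree) : int :=
  match i with DegM1 => - 1 | Deg0 => 0 | Deg1 => 1 end.

(* The direct sum is given by its three homogeneous components.  The bracket
   [loc_br i j k e] exists only when [e] witnesses that the degrees [i] and
   [j] add up to an admissible degree [k]; in the Jacobi identity the
   hypotheses say that all its terms are defined. *)
Record localLie (K : fieldType) := LocalLie {
  loc_comp :> degree -> vectType K;
  loc_br : forall i j k : degree, deg i + deg j = deg k ->
    {bilinear loc_comp i -> loc_comp j -> loc_comp k};
  loc_anti : forall (i j k : degree) (e : deg i + deg j = deg k)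
      (e' : deg j + deg i = deg k) (x : loc_comp i) (y : loc_comp j),
    loc_br e x y = - loc_br e' y x;
  loc_jacobi : forall (i j k ij jk ki l : degree)
      (eij : deg i + deg j = deg ij) (ejk : deg j + deg k = deg jk)
      (eki : deg k + deg i = deg ki) (eij_k : deg ij + deg k = deg l)
      (ejk_i : deg jk + deg i = deg l) (eki_j : deg ki + deg j = deg l)
      (x : loc_comp i) (y : loc_comp j) (z : loc_comp k),
    loc_br eij_k (loc_br eij x y) z + loc_br ejk_i (loc_br ejk y z) x
      + loc_br eki_j (loc_br eki z x) y = 0
}.

Arguments loc_br {K} L {i j k} e : rename.

Definition local_iso (K : fieldType) (L L' : localLie K)
    (Psi : forall i, {linear L i -> L' i}) : Prop :=
  (forall i, bijective (Psi i)) /\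
  (forall (i j k : degree) (e : deg i + deg j = deg k) (x : L i) (y : L j),
     Psi k (loc_br L e x y) = loc_br L' e (Psi i x) (Psi j y)).

Section GammaTriplet.
Variables (K : fieldType) (T : fundTriplet K).
Let g := ft_alg T.
Let V := ft_space T.
Let rho : lieRep g V := ft_rep T.
Let B : {symmetric g} := quad_form g.

Definition form_flat_fun (U : g) : dual g := linfun (B U : g -> K^o).

Lemma form_flat_funE U W : form_flat_fun U W = B U W.
Proof. by rewrite lfunE. Qed.

Fact form_flat_linear : linear form_flat_fun.
Proof.
move=> a U U'; apply/lfunP => W.
by rewrite add_lfunE scale_lfunE !form_flat_funE linearPl.
Qed.
HB.instance Definition _ :=
  GRing.isLinear.Build K g (dual g) _ form_flat_fun form_flat_linear.

Definition form_flat : 'Hom(g, dual g) := linfun form_flat_fun.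

Lemma form_flatE U W : form_flat U W = B U W.
Proof. by rewrite lfunE /= form_flat_funE. Qed.

Lemma form_eq0 (U : g) : (forall W, B U W = 0) -> U = 0.
Proof.
move=> BU; apply/eqP; rewrite -memv0 -(eqP (quad_nondeg g)).
by apply/mem_orthovP => W _; apply: BU.
Qed.

Lemma form_inj (U U' : g) : (forall W, B U W = B U' W) -> U = U'.
Proof.
move=> BU; apply/eqP; rewrite -subr_eq0; apply/eqP/form_eq0 => W.
by rewrite linearBl /= BU subrr.
Qed.

Lemma lker_form_flat : lker form_flat == 0%VS.
Proof.
apply/lker0P => U U' eqU; apply: form_inj => W.
by rewrite -!form_flatE eqU.
Qed.

Lemma limg_form_flat : limg form_flat = fullv.
Proof.
apply/eqP; rewrite eqEdim subvf limg_dim_eq ?(eqP lker_form_flat) ?capv0 //.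
by rewrite !dimvf /= /dim /= muln1.
Qed.

(* [moment X Y] is the unique element of [g] satisfying [momentE] below. *)
Definition moment_form (X : V) (Y : dual V) : dual g :=
  linfun (fun U : g => Y (rho U X)).

Definition moment (X : V) (Y : dual V) : g :=
  (form_flat^-1)%VF (moment_form X Y).

Fact moment_fun_linear (X : V) (Y : dual V) :
  linear (fun U : g => Y (rho U X)).
Proof. by move=> a U U'; rewrite linearP !lfunE /= lfunE /= linearP. Qed.

Lemma moment_formE X Y U : moment_form X Y U = Y (rho U X).
Proof.
pose h := GRing.isLinear.Build K g K^o _ _ (moment_fun_linear X Y).
pose f : {linear g -> K^o} := HB.pack (fun U : g => Y (rho U X)) h.
by rewrite /moment_form (lfunE f).
Qed.

Lemma momentE X Y U : B (moment X Y) U = Y (rho U X).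
Proof.
rewrite -form_flatE limg_lfunVK ?limg_form_flat ?memvf //.
exact: moment_formE.
Qed.

Lemma moment_equiv (U : g) (X : V) (Y : dual V) :
  lie U (moment X Y)
    = moment (rho U X) Y + moment X (contragredient rho U Y).
Proof.
apply: form_inj => W.
rewrite lieC linearNl /= quad_inv momentE linearDl /= !momentE contra_mapE.
by rewrite rep_lie linearB /= opprB.
Qed.

Fact momentPl a X X' Y :
  moment (a *: X + X') Y = a *: moment X Y + moment X' Y.
Proof.
by apply: form_inj => W; rewrite linearPl /= !momentE !linearP.
Qed.

Fact momentPr a X Y Y' :
  moment X (a *: Y + Y') = a *: moment X Y + moment X Y'.
Proof.
apply: form_inj => W; rewrite linearPl /= !momentE.
by rewrite add_lfunE scale_lfunE.
Qed.

Fact momentNl X Y : moment (- X) Y = - moment X Y.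
Proof.
by apply: form_inj => W; rewrite linearNl /= !momentE !linearN.
Qed.

Fact momentNr X Y : moment X (- Y) = - moment X Y.
Proof.
by apply: form_inj => W; rewrite linearNl /= !momentE opp_lfunE.
Qed.

Definition Gamma_comp (i : degree) : vectType K :=
  match i with DegM1 => dual V | Deg0 => g | Deg1 => V end.

(* The value 0 is only taken in degrees where no bracket is defined. *)
Definition Gamma_br (i j k : degree) :
    Gamma_comp i -> Gamma_comp j -> Gamma_comp k :=
  match i, j, k with
  | Deg0, Deg0, Deg0 => fun U U' => lie U U'
  | Deg0, Deg1, Deg1 => fun U X => rho U X
  | Deg1, Deg0, Deg1 => fun X U => - rho U X
  | Deg0, DegM1, DegM1 => fun U Y => contragredient rho U Y
  | DegM1, Deg0, DegM1 => fun Y U => - contragredient rho U Y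
  | Deg1, DegM1, Deg0 => fun X Y => moment X Y
  | DegM1, Deg1, Deg0 => fun Y X => - moment X Y
  | _, _, _ => fun _ _ => 0
  end.

Fact Gamma_br_bilinear i j k :
  bilinear_for
    (GRing.Scale.Law.clone _ _ *:%R _) (GRing.Scale.Law.clone _ _ *:%R _)
    (@Gamma_br i j k).
Proof.
case: i j k => [] [] [] /=; split=> u a x y /=;
  rewrite ?scaler0 ?addr0 // ?linearPl ?linearPr //;
  by rewrite ?(repPl rho) ?(repPl (contragredient rho)) ?momentPl ?momentPr ?linearP ?scalerN ?opprD.
Qed.
HB.instance Definition _ i j k :=
  bilinear_isBilinear.Build K (Gamma_comp i) (Gamma_comp j) (Gamma_comp k)
    _ _ (@Gamma_br i j k) (Gamma_br_bilinear i j k).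

Fact Gamma_anti (i j k : degree) (e : deg i + deg j = deg k)
    (e' : deg j + deg i = deg k) (x : Gamma_comp i) (y : Gamma_comp j) :
  @Gamma_br i j k x y = - @Gamma_br j i k y x.
Proof.
case: i j k e e' x y => [] [] [] //= _ _ x y; rewrite ?opprK //.
exact: lieC.
Qed.

Fact Gamma_jacobi (i j k ij jk ki l : degree)
    (eij : deg i + deg j = deg ij) (ejk : deg j + deg k = deg jk)
    (eki : deg k + deg i = deg ki) (eij_k : deg ij + deg k = deg l)
    (ejk_i : deg jk + deg i = deg l) (eki_j : deg ki + deg j = deg l)
    (x : Gamma_comp i) (y : Gamma_comp j) (z : Gamma_comp k) :
  @Gamma_br ij k l (@Gamma_br i j ij x y) z
    + @Gamma_br jk i l (@Gamma_br j k jk y z) x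
    + @Gamma_br ki j l (@Gamma_br k i ki z x) y = 0.
Proof.
move: eij ejk eki eij_k ejk_i eki_j x y z.
case: i; case: j; case: ij => // _; case: k; case: jk => // _;
  case: ki => // _; case: l => // _ _ _ /= x y z.
all: rewrite ?lie_jacobi // ?momentNl ?momentNr ?linearNl ?linearN /= ?linearN.
all: rewrite ?[lie (moment _ _) _]lieC ?rep_lie ?(rep_lie (contragredient rho)).
all: rewrite ?moment_equiv /= ?opprK ?opprB ?opprD ?addrA.
all: first
  [ by rewrite [LHS](ACl ((1*2)*(3*4))) /= ?subrr ?addNr ?addr0
  | by rewrite [LHS](ACl ((1*3)*(2*4))) /= ?subrr ?addNr ?addr0
  | by rewrite [LHS](ACl ((1*4)*(2*3))) /= ?subrr ?addNr ?addr0].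
Qed.

Definition Gamma : localLie K :=
  @LocalLie K Gamma_comp (fun i j k _ => @Gamma_br i j k)
    Gamma_anti Gamma_jacobi.

End GammaTriplet.

Definition triplet_iso (K : fieldType) (T T' : fundTriplet K)
    (A : {linear ft_alg T -> ft_alg T'})
    (gamma : {linear ft_space T -> ft_space T'}) : Prop :=
  [/\ bijective A,
      forall U U', A (lie U U') = lie (A U) (A U'),
      bijective gamma,
      forall U U', quad_form (ft_alg T') (A U) (A U') =
                   quad_form (ft_alg T) U U' &
      forall U X, ft_rep T' (A U) (gamma X) = gamma (ft_rep T U X)].

Definition extends_triplet_map (K : fieldType) (T T' : fundTriplet K)
    (A : {linear ft_alg T -> ft_alg T'})
    (gamma : {linear ft_space T -> ft_space T'})
    (Psi : forall i, {linear Gamma T i -> Gamma T' i}) : Prop :=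
  Psi Deg0 =1 A /\ Psi Deg1 =1 gamma.

Definition in_span (K : fieldType) (V : vectType K) (S : V -> Prop) (v : V) :=
  exists2 s : seq V, forall x, x \in s -> S x & v \in <<s>>%VS.

(* Main.v *)
Require Import Defs.
From HB Require Import structures.
From mathcomp Require Import all_boot all_order all_algebra.
From mathcomp Require Import reals complex.

Set Implicit Arguments.
Unset Strict Implicit.
Unset Printing Implicit Defensive.

Import GRing.Theory.
Local Open Scope ring_scope.

(** In degree -1 the extension is the transpose of the inverse of gamma,
    Y |-> Y o gamma^-1.  It is compatible with the bracket g_0 x V^* because
    gamma intertwines rho_1 and rho_2, and with the bracket V x V^* because
    that bracket is defined from B_0 and rho alone, which (A, gamma) preserves:
    B_2([gamma X, Y o gamma^-1], A U) = Y (rho_1 U X) = B_1([X, Y], U), and A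
    is surjective ([moment_triplet_iso]).

    For uniqueness, let P be the degree -1 part of any extension.  Pairing
    A [X, Y] = [gamma X, P Y] with A U under B_2 gives
    Y (rho_1 U X) = (P Y) (gamma (rho_1 U X)), so the functional P Y o gamma
    is equal to Y on all vectors rho_1 U X ([extension_pairing]).  If these
    span V_1, then P Y is determined on the image of gamma, which is V_2. *)

Section Linear.
Variables (K : fieldType) (V W : vectType K).

(** The inverse is taken in 'Hom(W, V) and not as a mere function, since it
    has to be transposed. *)
Lemma linear_bij_invK (f : {linear V -> W}) :
  bijective f ->
  cancel f (linfun f)^-1%VF /\ cancel (linfun f)^-1%VF f.
Proof.
move=> bij_f.
have fK : cancel f (linfun f)^-1%VF.
  move=> v; rewrite -(lfunE f) lker0_lfunK //.
  by apply/lker0P => x y; rewrite !lfunE; apply: bij_inj.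
by split=> //; apply/(bij_can_sym bij_f).
Qed.

Definition transpose (f : 'Hom(V, W)) (Y : dual W) : dual V := (Y \o f)%VF.

Fact transpose_linear f : linear (transpose f).
Proof. by move=> a Y Z; rewrite /transpose comp_lfunDl comp_lfunZl. Qed.
HB.instance Definition _ f :=
  GRing.isLinear.Build K (dual W) (dual V) _ (transpose f)
    (transpose_linear f).

Lemma transposeE f Y v : transpose f Y v = Y (f v).
Proof. exact: comp_lfunE. Qed.

Lemma eq_on_in_span (S : V -> Prop) (f h : {linear V -> W}) :
  (forall x, S x -> f x = h x) -> forall v, in_span S v -> f v = h v.
Proof.
move=> eq_fh v [s sS s_v].
rewrite (coord_span (X := in_tuple s) s_v) !linear_sum.
apply: eq_bigr => i _; rewrite !linearZ /=.
by congr (_ *: _); apply/eq_fh/sS/mem_nth.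
Qed.

End Linear.

Lemma transposeK (K : fieldType) (V W : vectType K)
    (f : 'Hom(V, W)) (h : 'Hom(W, V)) :
  cancel f h -> cancel (transpose h) (transpose f).
Proof. by move=> fK Y; apply/lfunP => v; rewrite !transposeE fK. Qed.

Section TripletIso.
Variables (K : fieldType) (T1 T2 : fundTriplet K).
Variables (A : {linear ft_alg T1 -> ft_alg T2}).
Variables (gamma : {linear ft_space T1 -> ft_space T2}).
Hypothesis isoT : triplet_iso A gamma.

Let gammaV : 'Hom(ft_space T2, ft_space T1) := (linfun gamma)^-1%VF.

Let gammaK : cancel gamma gammaV.
Proof. by case: isoT => _ _ /linear_bij_invK[]. Qed.

Let gammaVK : cancel gammaV gamma.
Proof. by case: isoT => _ _ /linear_bij_invK[]. Qed.

(** [moment] is characterised by its B_0-products ([momentE]), so it suffices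
    to compare the products with all W; as A is onto, W = A U, and invariance
    of B_0 and of the representation under (A, gamma) applies. *)
Lemma moment_triplet_iso X Y :
  A (moment X Y) = moment (gamma X) (transpose gammaV Y).
Proof.
case: isoT => -[A' AK A'K] _ _ BA rhoA; apply: form_inj => W.
by rewrite -(A'K W) BA !momentE transposeE rhoA gammaK.
Qed.

Lemma contragredient_triplet_iso U Y :
  transpose gammaV (contragredient (ft_rep T1) U Y) =
  contragredient (ft_rep T2) (A U) (transpose gammaV Y).
Proof.
case: isoT => _ _ _ _ rhoA; apply/lfunP => X.
by rewrite transposeE !contra_mapE transposeE -{2}(gammaVK X) rhoA gammaK.
Qed.

Definition Gamma_map (i : degree) : {linear Gamma T1 i -> Gamma T2 i} :=
  match i return {linear Gamma T1 i -> Gamma T2 i} with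
  | DegM1 => transpose gammaV
  | Deg0 => A
  | Deg1 => gamma
  end.

Lemma Gamma_map_iso : local_iso Gamma_map.
Proof.
case: (isoT) => bijA lieA bij_gamma _ rhoA; split=> [[] //|].
  exists (transpose (linfun gamma)); apply: transposeK => v.
    by rewrite lfunE gammaK.
  by rewrite lfunE gammaVK.
move=> [] [] [] //= _ x y.
- by rewrite linearN /=; congr (- _); apply: contragredient_triplet_iso.
- by rewrite linearN /= moment_triplet_iso.
- exact: contragredient_triplet_iso.
- exact: moment_triplet_iso.
- by rewrite linearN /=; congr (- _); apply/esym/rhoA.
Qed.

(** The B_0-product with A U turns the compatibility of Psi with the bracket
    V x V^* into a statement about the values of Psi Y; only vectors of the
    form rho U X are reached, whence the spanning hypothesis for uniqueness. *)
Lemma extension_pairing (Psi : forall i, {linear Gamma T1 i -> Gamma T2 i}) :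
  local_iso Psi -> extends_triplet_map A gamma Psi ->
  forall (Y : dual (ft_space T1)) U X,
    (Psi DegM1 Y : dual (ft_space T2)) (gamma (ft_rep T1 U X)) =
    Y (ft_rep T1 U X).
Proof.
case: isoT => _ _ _ BA rhoA [_ PsiM] [Psi0 Psi1] Y U X.
have := PsiM Deg1 DegM1 Deg0 erefl X Y; rewrite /= Psi0 Psi1.
move=> A_moment; rewrite -rhoA -momentE -[RHS]momentE -BA.
by rewrite A_moment.
Qed.

Lemma extension_unique
    (Psi Psi' : forall i, {linear Gamma T1 i -> Gamma T2 i}) :
  (forall v : ft_space T1,
      in_span (fun w => exists U X, w = ft_rep T1 U X) v) ->
  local_iso Psi -> extends_triplet_map A gamma Psi ->
  local_iso Psi' -> extends_triplet_map A gamma Psi' ->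
  forall i, Psi i =1 Psi' i.
Proof.
move=> spanV iso ext iso' ext' [] x; last 2 first.
- by rewrite ext.1 ext'.1.
- by rewrite ext.2 ext'.2.
(* Both images of x are compared after composition with gamma, which turns
   them into functionals on V_1, where the spanning vectors live. *)
apply/lfunP => w; rewrite -(gammaVK w) -(lfunE gamma).
rewrite -!(transposeE (linfun gamma)).
apply: eq_on_in_span (spanV (gammaV w)) => _ [U [X ->]].
by rewrite /= !transposeE lfunE !extension_pairing.
Qed.

End TripletIso.

Theorem theorem3p2p5 (R : realType) (T1 T2 : fundTriplet R[i])
    (A : {linear ft_alg T1 -> ft_alg T2})
    (gamma : {linear ft_space T1 -> ft_space T2}) :
  triplet_iso A gamma ->
  (exists Psi : forall i, {linear Gamma T1 i -> Gamma T2 i},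
      local_iso Psi /\ extends_triplet_map A gamma Psi) /\
  ((forall v : ft_space T1,
      in_span (fun w => exists U X, w = ft_rep T1 U X) v) ->
   forall Psi Psi' : forall i, {linear Gamma T1 i -> Gamma T2 i},
     local_iso Psi -> extends_triplet_map A gamma Psi ->
     local_iso Psi' -> extends_triplet_map A gamma Psi' ->
     forall i, Psi i =1 Psi' i).
Proof.
move=> isoT; split; last by move=> spanV Psi Psi'; apply: extension_unique.
by exists (Gamma_map A gamma); split; first exact: Gamma_map_iso.
Qed.
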